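(* Let $n\ge 1$ and let $k_1,k_2,\ldots,k_n$ be arbitrary positive integers. Let $S_n$ denote the symmetric group of degree $n$. Then \[ \sum_{\sigma\in S_n}\zeta_{\mathcal F}(k_{\sigma(1)},k_{\sigma(2)},\ldots,k_{\sigma(n)})=0 \quad\text{in } \mathcal Z/\zeta(2)\mathcal Z . \] Equivalently, $\sum_{\sigma\in S_n}\zeta^{*}_{\mathcal F}(k_{\sigma(1)},\ldots,k_{\sigma(n)})$ lies in the principal ideal $\zeta(2)\mathcal Z$ of $\mathcal Z$.
   Context: For positive integers $k_1,\ldots,k_n$ with $k_1\ge 2$, the multiple zeta value is $\zeta(k_1,\ldots,k_n)=\sum_{m_1>m_2>\cdots>m_n\ge 1} m_1^{-k_1}\cdots m_n^{-k_n}$. Let $\mathcal Z$ be the $\mathbb Q$-vector subspace of $\mathbb R$ spanned by all multiple zeta values (it is a $\mathbb Q$-algebra). For arbitrary positive integers $k_1,\dots,k_n$ (allowing $k_1=1$), $\zeta^{*}(k_1,\ldots,k_n)\in\mathcal Z$ denotes the harmonic-regularized value and $\zeta^{ш}(k_1,\ldots,k_n)\in\mathcal Z$ the shuffle-regularized value in the sense of Ihara–Kaneko–Zagier: the constant terms ($T=0$) of the harmonic (resp. shuffle) regularization polynomials in $T$, these being the unique extensions of the convergent values compatible with the harmonic (stuffle) product, resp. the shuffle product, with $\zeta^*(1)=\zeta^{ш}(1)=T$; both coincide with $\zeta$ on convergent indices, and $\zeta^*(\emptyset)=\zeta^{ш}(\emptyset)=1$. Define \[\zeta^{*}_{\mathcal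 F}(k_1,\ldots,k_n)=\sum_{i=0}^{n}(-1)^{k_1+\cdots+k_i}\zeta^{*}(k_i,k_{i-1},\ldots,k_1)\,\zeta^{*}(k_{i+1},k_{i+2},\ldots,k_n),\] and $\zeta^{ш}_{\mathcal F}$ by the same formula with $\zeta^{ш}$ in place of $\zeta^*$. It is known (Kaneko–Zagier) that $\zeta^{*}_{\mathcal F}(\mathbf k)-\zeta^{ш}_{\mathcal F}(\mathbf k)\in\zeta(2)\mathcal Z$. The finite real multiple zeta value is $\zeta_{\mathcal F}(k_1,\ldots,k_n):=\zeta^{*}_{\mathcal F}(k_1,\ldots,k_n) \bmod \zeta(2)$, an element of the quotient ring $\mathcal Z/\zeta(2)\mathcal Z$. *)

(* Defs.v *)
From HB Require Import structures.
From mathcomp Require Import all_boot all_order all_algebra all_fingroup.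
From mathcomp Require Import generic_quotient ring_quotient.
From mathcomp Require Import all_classical all_reals all_analysis.
From mathcomp Require Import polyorder polyrcf.
From mathcomp Require Import ring lra.

Set Implicit Arguments.
Unset Strict Implicit.
Unset Printing Implicit Defensive.

Import Order.TTheory GRing.Theory Num.Theory.
Import numFieldNormedType.Exports.
Import Quotient.

Local Open Scope classical_set_scope.
Local Open Scope ring_scope.

Definition posnat := {m : nat | (0 < m)%N}.

Definition posn (m : nat) (m_gt0 : (0 < m)%N) : posnat := exist _ m m_gt0.

Definition onep : posnat := @posn 1 isT.
Definition twop : posnat := @posn 2 isT.

Lemma addp_subproof (a b : posnat) : (0 < val a + val b)%N.
Proof. by rewrite addn_gt0 (valP a). Qed.

Definition addp (a b : posnat) : posnat := posn (addp_subproof a b).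

Definition mzindex := seq posnat.

Definition admissible (k : mzindex) : bool :=
  if k is a :: _ then (1 < val a)%N else true.

(* The harmonic (stuffle) product of two words, as the list with multiplicity *)
(* of the words occurring in it.                                              *)
Fixpoint stuffle (u : mzindex) : mzindex -> seq mzindex :=
  match u with
  | [::] => fun v => [:: v]
  | a :: u' =>
    fix stuffle_r (v : mzindex) : seq mzindex :=
      match v with
      | [::] => [:: u]
      | b :: v' => [seq a :: w | w <- stuffle u' v]
                ++ [seq b :: w | w <- stuffle_r v']
                ++ [seq addp a b :: w | w <- stuffle u' v']
      end
  end.

Section MultipleZeta.
Variable R : realType.
Implicit Types (k u v w : mzindex) (N : nat).

(* \sum_(N > m_1 > ... > m_n >= 1) m_1 ^- k_1 ... m_n ^- k_n *)
Fixpoint mzv_trunc k : R^nat := fun N =>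
  if k is a :: k' then
    \sum_(1 <= m < N) (m%:R ^- val a) * mzv_trunc k' m
  else 1.

Definition mzv k : R := limn (mzv_trunc k).

Definition is_harmonic_reg (Z : mzindex -> {poly R}) : Prop :=
  [/\ forall k, admissible k -> Z k = (mzv k)%:P,
      Z [:: onep] = 'X
    & forall u v, Z u * Z v = \sum_(w <- stuffle u v) Z w].

(* The default value of xget is never used: see harmonic_regP, and            *)
(* is_harmonic_reg_uniq for the uniqueness of the regularization.             *)
Definition harmonic_reg : mzindex -> {poly R} :=
  xget (fun=> 0) [set Z | is_harmonic_reg Z].

(* The Q-span of the multiple zeta values, with mzv [::] = 1 among them. *)
Definition mzv_span : {pred R} := fun x =>
  `[< exists s : seq (rat * mzindex),
        all (fun c => admissible c.2) s /\
        x = \sum_(c <- s) ratr c.1 * mzv c.2 >].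

Definition harmsum : R^nat := mzv_trunc [:: onep].

Lemma mzv_truncS a k N : (0 < N)%N ->
  mzv_trunc (a :: k) N.+1 =
  mzv_trunc (a :: k) N + (N%:R ^- val a) * mzv_trunc k N.
Proof. by move=> N0 /=; rewrite big_nat_recr. Qed.

Lemma mzv_trunc0 a k N : (N <= 1)%N -> mzv_trunc (a :: k) N = 0.
Proof. by move=> N1 /=; rewrite big_geq. Qed.

Lemma stuffleE a b u v : stuffle (a :: u) (b :: v) =
  [seq a :: w | w <- stuffle u (b :: v)]
  ++ [seq b :: w | w <- stuffle (a :: u) v]
  ++ [seq addp a b :: w | w <- stuffle u v].
Proof. by []. Qed.

Lemma stufflenil u : stuffle u [::] = [:: u].
Proof. by case: u. Qed.

Lemma mzv_trunc_stuffle u v N :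
  mzv_trunc u N * mzv_trunc v N = \sum_(w <- stuffle u v) mzv_trunc w N.
Proof.
elim: u v N => [|a u IHu] v N; first by rewrite big_seq1 mul1r.
elim: v N => [|b v IHv] N; first by rewrite stufflenil big_seq1 mulr1.
rewrite stuffleE !big_cat !big_map.
elim: N => [|N IHN].
  rewrite (mzv_trunc0 a u) // mul0r.
  by rewrite !big1 => [|w _|w _|w _]; rewrite ?mzv_trunc0 //= ?addr0.
case: N IHN => [|N] IHN.
  rewrite (mzv_trunc0 a u) // mul0r.
  by rewrite !big1 => [|w _|w _|w _]; rewrite ?mzv_trunc0 //= ?addr0.
pose F c (L : seq mzindex) M := \sum_(w <- L) mzv_trunc (c :: w) M.
have FE c L : F c L N.+2 = F c L N.+1 +
    (N.+1%:R ^- val c) * \sum_(w <- L) mzv_trunc w N.+1.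
  rewrite /F mulr_sumr -big_split; apply: eq_bigr => w _.
  exact: (@mzv_truncS c w N.+1).
have {}IHN : mzv_trunc (a :: u) N.+1 * mzv_trunc (b :: v) N.+1 =
    F a (stuffle u (b :: v)) N.+1 + (F b (stuffle (a :: u) v) N.+1 +
    F (addp a b) (stuffle u v) N.+1) by exact: IHN.
suff : mzv_trunc (a :: u) N.+2 * mzv_trunc (b :: v) N.+2 =
    F a (stuffle u (b :: v)) N.+2 + (F b (stuffle (a :: u) v) N.+2 +
    F (addp a b) (stuffle u v) N.+2) by [].
rewrite !FE -IHu -IHv -IHu !(mzv_truncS _ _ (isT : (0 < N.+1)%N)).
have -> : N.+1%:R ^- val (addp a b) = N.+1%:R ^- val a * N.+1%:R ^- val b :> R.
  by rewrite [val (addp a b)]/= exprD invfM.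
rewrite mulrDl !mulrDr IHN; ring.
Qed.

Lemma mzv_trunc_ge0 k N : 0 <= mzv_trunc k N.
Proof.
elim: k N => [|a k IH] N //=; apply: sumr_ge0 => m _.
by rewrite mulr_ge0.
Qed.

Lemma mzv_trunc_ndec k : nondecreasing_seq (mzv_trunc k).
Proof.
apply/nondecreasing_seqP => -[|N].
  by case: k => [|a k] //; rewrite mzv_trunc0// mzv_trunc_ge0.
case: k => [|a k] //; rewrite (@mzv_truncS _ _ N.+1) // lerDl mulr_ge0 //.
exact: mzv_trunc_ge0.
Qed.

Lemma mzv_trunc_leH k N : mzv_trunc k N <= harmsum N ^+ size k.
Proof.
elim: k N => [|a k IH] N //.
rewrite exprS {1}/harmsum /= mulr_suml; apply: ler_sum_nat => m /andP[m1 mN].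
rewrite mulr1; apply: ler_pM => //; first exact: mzv_trunc_ge0.
  rewrite expr1 lef_pV2 ?posrE ?exprn_gt0 ?ltr0n //.
  by rewrite -[leLHS]expr1 ler_weXn2l ?ler1n // (valP a).
apply: le_trans (IH m) _; apply: lerXn2r; rewrite ?nnegrE ?mzv_trunc_ge0 //.
exact/mzv_trunc_ndec/ltnW.
Qed.

Lemma HS N : (0 < N)%N -> harmsum N.+1 = harmsum N + N%:R^-1.
Proof. by move=> N0; rewrite /harmsum mzv_truncS // mulr1 expr1. Qed.

Lemma H_pinfty : harmsum N @[N --> \oo] --> +oo.
Proof.
have dv := @dvg_harmonic R.
have nd : nondecreasing_seq (series (@harmonic R)).
  by apply/nondecreasing_series => n _ _; rewrite harmonic_ge0.
have Hs N : harmsum N.+1 = series (@harmonic R) N.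
  rewrite /harmsum /= seriesEnat /= big_add1 /=; apply: eq_bigr => i _.
  by rewrite mulr1 expr1.
rewrite -cvg_shiftS; under eq_fun do rewrite Hs.
exact: nondecreasing_dvgn_lt.
Qed.

(* Sequences negligible with respect to every power of the harmonic sums. *)
Definition rapid (E : R^nat) := forall j, E N * harmsum N ^+ j @[N --> \oo] --> 0.

Lemma rapid0 : rapid (fun=> 0).
Proof. by move=> j; under eq_fun do rewrite mul0r; exact: cvg_cst. Qed.

Lemma rapidD E F : rapid E -> rapid F -> rapid (fun N => E N + F N).
Proof.
move=> hE hF j; under eq_fun do rewrite mulrDl.
by rewrite -[0]addr0; apply: cvgD.
Qed.

Lemma rapidZ c E : rapid E -> rapid (fun N => c * E N).
Proof.
move=> hE j; under eq_fun do rewrite -mulrA.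
by rewrite -(mulr0 c); apply: cvgMr.
Qed.

Lemma rapidH E : rapid E -> rapid (fun N => harmsum N * E N).
Proof.
move=> hE j; under eq_fun do rewrite mulrAC -exprS mulrC.
exact: hE.
Qed.

Lemma rapidM E F : rapid E -> rapid F -> rapid (fun N => E N * F N).
Proof.
move=> hE hF j; have {}hF := hF 0%N; under eq_fun do rewrite mulrAC -(mulr1 (F _)).
by rewrite -(mulr0 0); apply: cvgM.
Qed.

Lemma rapid_sum (I : eqType) (r : seq I) (E : I -> R^nat) :
  {in r, forall i, rapid (E i)} -> rapid (fun N => \sum_(i <- r) E i N).
Proof.
elim: r => [|i r IH] hE.
  by under eq_fun do rewrite big_nil; exact: rapid0.
under eq_fun do rewrite big_cons; apply: rapidD.
  by apply: hE; rewrite mem_head.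
by apply: IH => j jr; apply: hE; rewrite in_cons jr orbT.
Qed.

Lemma rapidP E (P : {poly R}) : rapid E -> rapid (fun N => P.[harmsum N] * E N).
Proof.
move=> hE; elim/poly_ind: P => [|P c IH].
  by under eq_fun do rewrite horner0 mul0r; exact: rapid0.
under eq_fun do rewrite hornerMXaddC mulrDl mulrAC mulrC.
by apply: rapidD; [exact: rapidH | exact: rapidZ].
Qed.

Lemma rapid_poly0 (P : {poly R}) : rapid (fun N => P.[harmsum N]) -> P = 0.
Proof.
suff wl (Q : {poly R}) : 0 < lead_coef Q -> ~ rapid (fun N => Q.[harmsum N]).
  move=> hP; apply: contrapT => /eqP P0.
  have := lead_coef_eq0 P; rewrite (negPf P0) => /negbT.
  rewrite neq_lt => /orP[l0|l0]; last exact: (wl P).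
  apply: (wl (- P)); first by rewrite lead_coefN oppr_gt0.
  under eq_fun do rewrite hornerN -mulN1r; exact: rapidZ.
move=> lQ /(_ 0%N); under eq_fun do rewrite mulr1.
have [x hx] := poly_pinfty_gt_lc lQ.
move=> /cvgrPdist_lt/(_ _ lQ) h1.
have /cvgryPge/(_ x) h2 := H_pinfty.
have [N /= [a b]] : exists N, (`|0 - Q.[harmsum N]| < lead_coef Q) /\ x <= harmsum N.
  by apply: (@filter_ex _ \oo); apply: filterS2 h1 h2.
have := hx _ b; rewrite sub0r normrN in a.
by move=> c; have := lt_le_trans a (le_trans c (ler_norm _)); rewrite ltxx.
Qed.

Lemma H_ge0 N : 0 <= harmsum N. Proof. exact: mzv_trunc_ge0. Qed.

(* Summability of m^-2 H_m^J: H_m^J = O(exp (H_m / 2)), and the series of     *)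
(* m^-2 exp (H_m / 2) is dominated by a telescoping one.                      *)
Let a_ N : R := expR (harmsum N / 2).

Let a_bound J N : harmsum N ^+ J <= (2 * J%:R) ^+ J * a_ N.
Proof.
case: J => [|J]; first by rewrite !expr0 mul1r -expR0 ler_expR divr_ge0 // H_ge0.
have -> : a_ N = expR (harmsum N / (2 * J.+1%:R)) ^+ J.+1.
  rewrite -expRM_natr; congr expR; rewrite invfM mulrA -mulrA mulVf ?mulr1 //.
rewrite -exprMn; apply: lerXn2r; rewrite ?nnegrE ?H_ge0 //.
have p : 0 < 2 * J.+1%:R :> R by rewrite mulr_gt0.
rewrite mulrC -ler_pdivrMr //.
by apply: le_trans (expR_ge1Dx _); rewrite lerDr.
Qed.

Let a_step N : (1 < N)%N ->
  N%:R ^- 2 * a_ N <= 5 * (a_ N / N%:R - a_ N.+1 / N.+1%:R).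
Proof.
move=> N1; set x : R := N%:R; have x2 : 2 <= x by rewrite ler_nat.
have x0 : 0 < x by lra.
have aE : a_ N.+1 = a_ N * expR ((2 * x)^-1).
  by rewrite /a_ HS 1?ltnW // mulrDl expRD invfM [x^-1 * _]mulrC.
have e1 : expR ((2 * x)^-1) <= (2 * x) / (2 * x - 1).
  have y0 : 0 < 1 - (2 * x)^-1.
    by rewrite subr_gt0 invf_lt1; lra.
  have := expR_ge1Dx (- (2 * x)^-1); rewrite expRN => h.
  rewrite -[leLHS]invrK; have -> : (2 * x) / (2 * x - 1) = (1 - (2 * x)^-1)^-1.
    by field; apply/andP; split; apply/eqP; lra.
  by rewrite lef_pV2 // posrE ?invr_gt0 ?expR_gt0.
have ap : 0 < a_ N by exact: expR_gt0.
have xE : N.+1%:R = x + 1 by rewrite -natr1.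
rewrite aE xE.
have e2 : a_ N * expR ((2 * x)^-1) / (x + 1) <= a_ N * (2 * x / (2 * x - 1)) / (x + 1).
  by rewrite ler_pM2r ?invr_gt0 ?ler_pM2l //; lra.
suff : x ^- 2 * a_ N <= 5 * (a_ N / x - a_ N * (2 * x / (2 * x - 1)) / (x + 1)).
  move=> h1; apply: le_trans h1 _; apply: ler_wpM2l => //; exact: lerB.
rewrite -subr_ge0.
have -> : 5 * (a_ N / x - a_ N * (2 * x / (2 * x - 1)) / (x + 1)) - x ^- 2 * a_ N
  = a_ N * ((3 * x ^+ 2 - 6 * x + 1) / (x ^+ 2 * (2 * x - 1) * (x + 1))).
  by field; apply/and3P; split; apply/eqP; lra.
apply: mulr_ge0; [lra|apply: divr_ge0; first nra].
by rewrite !mulr_ge0 ?exprn_ge0 //; lra.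
Qed.

Let S J N : R := \sum_(1 <= m < N) m%:R ^- 2 * harmsum m ^+ J.

Let S_bound J : exists M, forall N, S J N <= M.
Proof.
pose C : R := (2 * J%:R) ^+ J.
have C0 : 0 <= C by rewrite exprn_ge0 // mulr_ge0.
exists (harmsum 1 ^+ J + C * (5 * (a_ 2 / 2))) => N.
have [N2|N2] := leqP N 2.
  apply: (@le_trans _ _ (harmsum 1 ^+ J)); last first.
    by rewrite lerDl !mulr_ge0 ?expR_ge0.
  have H1J : 0 <= harmsum 1 ^+ J by rewrite exprn_ge0 // H_ge0.
  case: N N2 => [|[|[|N]]] // _; rewrite /S; [by rewrite big_geq..|].
  by rewrite big_nat1 expr1n invr1 mul1r.
rewrite /S big_ltn 1?ltnW // expr1n invr1 mul1r lerD2l.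
apply: (@le_trans _ _ (\sum_(2 <= m < N) C * (5 * (a_ m / m%:R - a_ m.+1 / m.+1%:R)))).
  apply: ler_sum_nat => m /andP[m2 _].
  apply: (@le_trans _ _ (C * (m%:R ^- 2 * a_ m))); last first.
    by rewrite ler_wpM2l // a_step.
  by rewrite mulrCA ler_wpM2l // a_bound.
rewrite -!mulr_sumr ler_wpM2l // ler_wpM2l //.
under eq_bigr do rewrite -opprB.
rewrite sumrN telescope_sumr 1?ltnW // opprB lerBlDr lerDl.
by rewrite divr_ge0 ?expR_ge0.
Qed.

Lemma S_cvg J : cvgn (S J).
Proof.
have nd : nondecreasing_seq (S J).
  apply/nondecreasing_seqP => -[|N]; first by rewrite /S !big_geq.
  by rewrite /S [leRHS]big_nat_recr //= lerDl mulr_ge0 // exprn_ge0 // H_ge0.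
apply: nondecreasing_is_cvgn => //.
have [M hM] := S_bound J; exists M => _ [N _ <-]; exact: hM.
Qed.

Lemma trunc_step (a : posnat) k m : (1 < val a)%N -> (0 < m)%N ->
  m%:R ^- val a * mzv_trunc k m <= m%:R ^- 2 * harmsum m ^+ size k :> R.
Proof.
move=> a1 m0; apply: ler_pM => //; first exact: mzv_trunc_ge0.
  rewrite lef_pV2 ?posrE ?exprn_gt0 ?ltr0n //.
  by rewrite ler_weXn2l ?ler1n.
exact: mzv_trunc_leH.
Qed.

Lemma mzv_trunc_cvg k : admissible k -> cvgn (mzv_trunc k).
Proof.
case: k => [|a k] adm; first exact: is_cvg_cst.
apply: nondecreasing_is_cvgn; first exact: mzv_trunc_ndec.
have [M hM] := S_bound (size k); exists M => _ [N _ <-].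
apply: le_trans (hM N); apply: ler_sum_nat => m /andP[m1 _].
exact: trunc_step.
Qed.

Lemma mzv_rapid k : admissible k -> rapid (fun N => mzv_trunc k N - mzv k).
Proof.
case: k => [|a k] adm j.
  rewrite /mzv /= lim_cst //.
  by under eq_fun do rewrite subrr mul0r; exact: cvg_cst.
set K := a :: k; have cK := mzv_trunc_cvg adm.
pose J := (size k + j)%N; have cS := @S_cvg J.
have tail N M : (0 < N <= M)%N ->
    (mzv_trunc K M - mzv_trunc K N) * harmsum N ^+ j <= S J M - S J N.
  move=> /andP[N0 NM]; rewrite /S /K /=.
  rewrite !(big_cat_nat N0 NM) /= [X in X * _]addrAC subrr add0r.
  rewrite [leRHS]addrAC subrr add0r mulr_suml.
  apply: ler_sum_nat => m /andP[Nm _].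
  rewrite exprD mulrA; apply: ler_pM; rewrite ?exprn_ge0 ?H_ge0 //.
  - by rewrite mulr_ge0 // mzv_trunc_ge0.
  - by apply: trunc_step => //; exact: leq_trans Nm.
  - apply: lerXn2r; rewrite ?nnegrE ?H_ge0 //; exact: mzv_trunc_ndec.
have tail2 N : (0 < N)%N ->
    (mzv K - mzv_trunc K N) * harmsum N ^+ j <= limn (S J) - S J N.
  move=> N0.
  have c1 : (mzv_trunc K M - mzv_trunc K N) * harmsum N ^+ j @[M --> \oo] -->
      (mzv K - mzv_trunc K N) * harmsum N ^+ j.
    by apply: cvgMl; apply: cvgB => //; exact: cvg_cst.
  have c2 : S J M - S J N @[M --> \oo] --> limn (S J) - S J N.
    by apply: cvgB => //; exact: cvg_cst.
  apply: (ler_cvg_to c1 c2); near=> M; apply: tail; rewrite N0.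
  by near: M; exact: nbhs_infty_ge.
have c0 : S J N - limn (S J) @[N --> \oo] --> 0.
  by rewrite -(subrr (limn (S J))); apply: cvgB => //; exact: cvg_cst.
apply: (@squeeze_cvgr _ _ _ _ (fun N => S J N - limn (S J)) (fun=> 0)).
- near=> N; apply/andP; split.
    rewrite -lerN2 opprB -mulNr opprB; apply: tail2.
    by near: N; exact: nbhs_infty_gt.
  rewrite mulr_le0_ge0 ?exprn_ge0 ?H_ge0 // subr_le0.
  by apply: nondecreasing_cvgn_le => //; exact: mzv_trunc_ndec.
- exact: c0.
- exact: cvg_cst.
Unshelve. all: by end_near.
Qed.

Lemma stuffle_adm u v : admissible u -> admissible v ->
  all admissible (stuffle u v).
Proof.
case: u => [|a u] au; first by move=> av /=; rewrite av.
case: v => [|b v] av; first by rewrite stufflenil /= andbT.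
rewrite stuffleE !all_cat; apply/and3P; split; apply/allP => _ /mapP[w _ ->] //.
by rewrite /= (leq_trans au) // leq_addr.
Qed.

Lemma mzvM u v : admissible u -> admissible v ->
  mzv u * mzv v = \sum_(w <- stuffle u v) mzv w.
Proof.
move=> au av; have /allP aw := stuffle_adm au av.
have c1 : mzv_trunc u N * mzv_trunc v N @[N --> \oo] --> mzv u * mzv v.
  by apply: cvgM; exact: mzv_trunc_cvg.
have c2 : \sum_(w <- stuffle u v) mzv_trunc w N @[N --> \oo] -->
    \sum_(w <- stuffle u v) mzv w.
  elim: (stuffle u v) aw => [|w L IH] aw.
    by under eq_fun do rewrite big_nil; rewrite big_nil; exact: cvg_cst.
  under eq_fun do rewrite big_cons; rewrite big_cons.
  apply: cvgD; first by apply: (@mzv_trunc_cvg w); apply: aw; rewrite mem_head.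
  by apply: IH => x xL; apply: aw; rewrite in_cons xL orbT.
move: c1; under eq_fun do rewrite mzv_trunc_stuffle.
by move=> c1; rewrite -(cvg_lim (@norm_hausdorff _ _) c1) (cvg_lim _ c2).
Qed.

Lemma mzv_spanP x : reflect (exists s : seq (rat * mzindex),
    all (fun c => admissible c.2) s /\ x = \sum_(c <- s) ratr c.1 * mzv c.2)
  (x \in mzv_span).
Proof. exact: asboolP. Qed.

Lemma mzv_in k : admissible k -> mzv k \in mzv_span.
Proof.
move=> ak; apply/mzv_spanP; exists [:: (1, k)].
by rewrite /= ak big_seq1 rmorph1 mul1r.
Qed.

Lemma mzv_nil : mzv [::] = 1. Proof. exact: lim_cst. Qed.

Lemma mzv_spanD x y : x \in mzv_span -> y \in mzv_span -> x + y \in mzv_span.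
Proof.
move=> /mzv_spanP[s [sa ->]] /mzv_spanP[t [ta ->]]; apply/mzv_spanP.
by exists (s ++ t); rewrite all_cat sa ta big_cat.
Qed.

Lemma mzv_spanZ q x : x \in mzv_span -> ratr q * x \in mzv_span.
Proof.
move=> /mzv_spanP[s [sa ->]]; apply/mzv_spanP.
exists [seq (q * c.1, c.2) | c <- s]; rewrite all_map; split => //.
rewrite big_map mulr_sumr; apply: eq_bigr => c _.
by rewrite rmorphM mulrA.
Qed.

Lemma mzv_span0 : 0 \in mzv_span.
Proof. by apply/mzv_spanP; exists [::]; rewrite big_nil. Qed.

Lemma mzv_span_sum (I : eqType) (r : seq I) (F : I -> R) :
  (forall i, i \in r -> F i \in mzv_span) -> \sum_(i <- r) F i \in mzv_span.
Proof.
move=> h; rewrite big_seq.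
by apply: (big_ind (fun x => x \in mzv_span) mzv_span0 mzv_spanD).
Qed.

Lemma mzv_spanM x y : x \in mzv_span -> y \in mzv_span -> x * y \in mzv_span.
Proof.
move=> /mzv_spanP[s [/allP sa ->]] /mzv_spanP[t [/allP ta ->]].
rewrite mulr_suml; apply: mzv_span_sum => c /sa ac.
rewrite mulr_sumr; apply: mzv_span_sum => d /ta ad.
rewrite -mulrA; apply: mzv_spanZ; rewrite mulrCA; apply: mzv_spanZ.
rewrite mzvM //; have /allP aw := stuffle_adm ac ad.
by apply: mzv_span_sum => w /aw; exact: mzv_in.
Qed.

Lemma mzv_span_subring : subring_closed mzv_span.
Proof.
split=> [|x y xZ yZ|x y]; first by rewrite -mzv_nil mzv_in.
  apply: mzv_spanD => //; rewrite -mulN1r.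
  by have := mzv_spanZ (-1) yZ; rewrite rmorphN1.
exact: mzv_spanM.
Qed.

HB.instance Definition _ := GRing.isSubringClosed.Build R mzv_span mzv_span_subring.

Fixpoint lead1 k : nat :=
  if k is a :: k' then (if val a == 1%N then (lead1 k').+1 else 0%N) else 0%N.

Lemma lead1_split k :
  exists2 k', admissible k' & k = nseq (lead1 k) onep ++ k'.
Proof.
elim: k => [|a k [k' ak e]]; first by exists [::].
rewrite /=; have [a1|a1] := eqVneq (val a) 1%N.
  exists k' => //=; rewrite -e; congr cons; exact: val_inj.
by exists (a :: k) => //=; rewrite ltn_neqAle eq_sym a1 (valP a).
Qed.

(* Multiplying by the letter 1 adds one leading 1, up to words with fewer     *)
(* leading 1s.                                                                *)
Lemma stuffle1 p k : admissible k -> exists2 L : seq mzindex,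
  all (fun w => lead1 w <= p)%N L &
  perm_eq (stuffle [:: onep] (nseq p onep ++ k))
          (nseq p.+1 (nseq p.+1 onep ++ k) ++ L).
Proof.
move=> ak; elim: p => [|p [L hL hp]].
  case: k ak => [|b k] /= ak; first by exists [::].
  eexists; last exact: perm_refl.
  rewrite all_cat; apply/andP; split; last first.
    by rewrite /= add1n eqSS (gtn_eqF (valP b)).
  apply/allP => _ /mapP[w _ ->] /=.
  by rewrite gtn_eqF.
exists ([seq onep :: w | w <- L] ++ [:: twop :: nseq p onep ++ k]).
  rewrite all_cat all_map /= andbT.
  by apply/allP => w /(allP hL).
set v := nseq p onep ++ k in hp *; set x := onep :: onep :: v.
have e : perm_eq [seq onep :: w | w <- stuffle [:: onep] v]
                 (nseq p.+1 x ++ [seq onep :: w | w <- L]).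
  by rewrite -[x]/(onep :: (onep :: v)) -map_nseq -map_cat; exact: perm_map.
have -> : twop = addp onep onep by exact: val_inj.
rewrite -[perm_eq _ _]/(perm_eq
  (x :: ([seq onep :: w | w <- stuffle [:: onep] v] ++ [:: addp onep onep :: v]))
  (x :: (nseq p.+1 x ++ [seq onep :: w | w <- L] ++ [:: addp onep onep :: v]))).
by rewrite perm_cons catA perm_cat2r.
Qed.

Lemma lead1_nseq p k : admissible k -> lead1 (nseq p onep ++ k) = p.
Proof.
by move=> ak; elim: p => [|p /= ->] //; case: k ak => //= b k /gtn_eqF->.
Qed.

Lemma rapid_ext E F : E =1 F -> rapid E -> rapid F.
Proof. by move=> /funext->. Qed.

Lemma reg_ex k : exists P : {poly R},
  P \is a polyOver mzv_span /\ rapid (fun N => mzv_trunc k N - P.[harmsum N]).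
Proof.
have [n] := ubnP (lead1 k); elim: n k => // n IHn k; rewrite ltnS => kn.
have [k' ak' ek] := lead1_split k; case: (lead1 k) ek kn => [|p] ek kn.
  exists (mzv k)%:P; rewrite ek polyOverC mzv_in //; split => //.
  by under eq_fun do rewrite hornerC; exact: mzv_rapid.
have {}IHn w : exists P : {poly R}, (lead1 w <= p)%N ->
    P \is a polyOver mzv_span /\ rapid (fun N => mzv_trunc w N - P.[harmsum N]).
  have [wp|//] := leqP (lead1 w) p; last by exists 0.
  by have [P hP] := IHn w (leq_ltn_trans wp kn); exists P.
have [f hf] := choice IHn.
have [L /allP hL hp] := stuffle1 p ak'.
set v := nseq p onep ++ k' in hp; have lv : (lead1 v <= p)%N by rewrite lead1_nseq.
have [fv1 fv2] := hf v lv.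
have p0 : p.+1%:R != 0 :> R by rewrite pnatr_eq0.
have ep : p.+1%:R^-1 = ratr (p.+1%:R^-1) :> R by rewrite fmorphV rmorph_nat.
exists (p.+1%:R^-1 *: ('X * f v - \sum_(w <- L) f w)); split.
  apply/polyOverP => i; rewrite coefZ ep mzv_spanZ //.
  apply/polyOverP: i; rewrite rpredB //; first by rewrite rpredM ?polyOverX.
  by rewrite big_seq rpred_sum // => w /hL /hf[].
have TE N : harmsum N * mzv_trunc v N =
    p.+1%:R * mzv_trunc k N + \sum_(w <- L) mzv_trunc w N.
  rewrite /harmsum mzv_trunc_stuffle (perm_big _ hp) big_cat big_nseq -ek.
  by rewrite iter_addr addr0 mulr_natl.
apply: (@rapid_ext (fun N => p.+1%:R^-1 * (harmsum N * (mzv_trunc v N - (f v).[harmsum N]) +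
    (-1) * \sum_(w <- L) (mzv_trunc w N - (f w).[harmsum N])))).
  move=> N; rewrite sumrB hornerZ hornerD hornerN horner_sum.
  rewrite hornerM hornerX mulrBr TE; move: p0; move: (p.+1%:R : R) => q p0.
  by field.
apply: rapidZ; apply: rapidD; first exact: rapidH.
by apply: rapidZ; apply: rapid_sum => w /hL/hf[].
Qed.

Lemma harmonic_reg_exists : exists2 Z, is_harmonic_reg Z &
  forall k, Z k \is a polyOver mzv_span.
Proof.
have [Z hZ] := choice reg_ex.
have ZP k (P : {poly R}) : rapid (fun N => mzv_trunc k N - P.[harmsum N]) -> Z k = P.
  move=> hP; apply/eqP; rewrite -subr_eq0; apply/eqP/rapid_poly0.
  apply: (@rapid_ext (fun N => (mzv_trunc k N - P.[harmsum N]) +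
      (-1) * (mzv_trunc k N - (Z k).[harmsum N]))).
    by move=> N; rewrite hornerD hornerN; ring.
  by apply: rapidD => //; apply: rapidZ; case: (hZ k).
exists Z => [|k]; last by case: (hZ k).
split=> [k ak||u v].
- by apply: ZP; under eq_fun do rewrite hornerC; exact: mzv_rapid.
- by apply: ZP; under eq_fun do rewrite hornerX subrr; exact: rapid0.
have [[_ hu] [_ hv]] := (hZ u, hZ v).
apply/eqP; rewrite -subr_eq0; apply/eqP/rapid_poly0.
pose eu N := mzv_trunc u N - (Z u).[harmsum N]; pose ev N := mzv_trunc v N - (Z v).[harmsum N].
apply: (@rapid_ext (fun N => ((-1) * ((Z v).[harmsum N] * eu N) +
    (-1) * ((Z u).[harmsum N] * ev N)) + ((-1) * (eu N * ev N) +
    \sum_(w <- stuffle u v) (mzv_trunc w N - (Z w).[harmsum N])))).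
  move=> N; rewrite sumrB -mzv_trunc_stuffle hornerD hornerN hornerM horner_sum.
  by rewrite /eu /ev; ring.
apply: rapidD; [apply: rapidD|apply: rapidD].
- by apply: rapidZ; exact: rapidP.
- by apply: rapidZ; exact: rapidP.
- by apply: rapidZ; exact: rapidM.
- by apply: rapid_sum => w _; case: (hZ w).
Qed.

Lemma is_harmonic_reg_uniq Z1 Z2 :
  is_harmonic_reg Z1 -> is_harmonic_reg Z2 -> Z1 = Z2.
Proof.
move=> [a1 b1 c1] [a2 b2 c2]; apply/funext => k.
have [n] := ubnP (lead1 k); elim: n k => // n IHn k; rewrite ltnS => kn.
have [k' ak' ek] := lead1_split k; case: (lead1 k) ek kn => [|p] ek kn.
  by rewrite ek a1 // a2.
have [L /allP hL hp] := stuffle1 p ak'.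
set v := nseq p onep ++ k' in hp; have lv : (lead1 v <= p)%N by rewrite lead1_nseq.
have E Z : Z [:: onep] = 'X ->
    (forall u v, Z u * Z v = \sum_(w <- stuffle u v) Z w) ->
    Z k = p.+1%:R^-1 *: ('X * Z v - \sum_(w <- L) Z w) :> {poly R}.
  move=> b c; rewrite -b c (perm_big _ hp) big_cat big_nseq -ek.
  rewrite iter_addr addr0 addrK.
  by rewrite -[X in _ *: X]scaler_nat scalerA mulVf ?scale1r // pnatr_eq0.
rewrite (E Z1) // (E Z2) // (IHn v (leq_ltn_trans lv kn)).
congr (_ *: (_ - _)); apply: eq_big_seq => w /hL wp.
exact: IHn (leq_ltn_trans wp kn).
Qed.

Lemma harmonic_regP : is_harmonic_reg harmonic_reg.
Proof. by have [Z hZ _] := harmonic_reg_exists; exact: (xgetI _ hZ). Qed.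

Lemma harmonic_reg_over k : harmonic_reg k \is a polyOver mzv_span.
Proof.
have [Z hZ oZ] := harmonic_reg_exists.
by rewrite (is_harmonic_reg_uniq harmonic_regP hZ).
Qed.

End MultipleZeta.

Section FiniteRealMZV.
Variable R : realType.

Record mzvalg := MZVAlg { mzvalg_val : R; _ : mzvalg_val \in @mzv_span R }.

HB.instance Definition _ := [isSub for mzvalg_val].
HB.instance Definition _ := [Choice of mzvalg by <:].
HB.instance Definition _ := [SubChoice_isSubComNzRing of mzvalg by <:].

Definition zeta2 : mzvalg := MZVAlg (@mzv_in R [:: twop] isT).

Lemma zeta_star_subproof k : (harmonic_reg R k).[0] \in @mzv_span R.
Proof. by rewrite rpred_horner ?rpred0 // harmonic_reg_over. Qed.

Definition zeta_star (k : mzindex) : mzvalg := MZVAlg (zeta_star_subproof k).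

Lemma zeta_star_adm k : admissible k -> val (zeta_star k) = mzv R k.
Proof. by case: (harmonic_regP R) => h _ _ /h /= ->; rewrite hornerC. Qed.

Definition weight (k : mzindex) : nat := \sum_(a <- k) val a.

Definition zeta_star_F (k : mzindex) : mzvalg :=
  \sum_(0 <= i < (size k).+1)
    (-1) ^+ weight (take i k) * zeta_star (rev (take i k)) * zeta_star (drop i k).

Definition zeta2_ideal : {pred mzvalg} := fun x =>
  `[< exists z : mzvalg, x = zeta2 * z >].

Lemma zeta2_idealP x : reflect (exists z, x = zeta2 * z) (x \in zeta2_ideal).
Proof. exact: asboolP. Qed.

Lemma zeta2_ideal_zmod : zmod_closed zeta2_ideal.
Proof.
split; first by apply/zeta2_idealP; exists 0; rewrite mulr0.
move=> x y /zeta2_idealP[z ->] /zeta2_idealP[t ->]; apply/zeta2_idealP.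
by exists (z - t); rewrite mulrBr.
Qed.

HB.instance Definition _ :=
  GRing.isZmodClosed.Build mzvalg zeta2_ideal zeta2_ideal_zmod.

Lemma zeta2_idealMl a x : x \in zeta2_ideal -> a * x \in zeta2_ideal.
Proof.
by move=> /zeta2_idealP[z ->]; apply/zeta2_idealP; exists (a * z); rewrite mulrCA.
Qed.

(* {ideal_quot _} requires a proper ideal, and it is not known that 1 is not  *)
(* in zeta2_ideal; the possibly trivial ring structure is built by hand.      *)
Definition mzvalg_mod : Type := {quot zeta2_ideal}.

HB.instance Definition _ := GRing.Zmodule.on mzvalg_mod.
HB.instance Definition _ := ZmodQuotient.on mzvalg_mod.

Local Open Scope quotient_scope.

Lemma pi_mzvalgD : {morph \pi_mzvalg_mod : x y / x + y}.
Proof. exact: pi_addr. Qed.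

Lemma pi_mzvalg0 : \pi_mzvalg_mod 0 = 0.
Proof. exact: pi_zeror. Qed.

Definition mzvalg_mod1 : mzvalg_mod := lift_cst mzvalg_mod 1.
Definition mzvalg_mod_mul := lift_op2 mzvalg_mod *%R.

Canonical pi_mzvalg_mod1 := PiConst mzvalg_mod1.

Lemma pi_mzvalg_mul : {morph \pi_mzvalg_mod : x y / x * y >-> mzvalg_mod_mul x y}.
Proof.
move=> x y; unlock mzvalg_mod_mul; apply/eqP; rewrite piE equivE.
rewrite -[_ * _](addrNK (x * repr (\pi_mzvalg_mod y))) -mulrBr.
rewrite -addrA -mulrBl rpredD //.
  by rewrite zeta2_idealMl // idealrDE opprK reprK.
by rewrite mulrC zeta2_idealMl // idealrDE opprK reprK.
Qed.

Canonical pi_mzvalg_mul_morph := PiMorph2 pi_mzvalg_mul.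

Lemma mzvalg_modA : associative mzvalg_mod_mul.
Proof. by move=> x y z; rewrite -[x]reprK -[y]reprK -[z]reprK !piE mulrA. Qed.

Lemma mzvalg_modC : commutative mzvalg_mod_mul.
Proof. by move=> x y; rewrite -[x]reprK -[y]reprK !piE mulrC. Qed.

Lemma mzvalg_mod1l : left_id mzvalg_mod1 mzvalg_mod_mul.
Proof. by move=> x; rewrite -[x]reprK !piE mul1r. Qed.

Lemma mzvalg_modDl : left_distributive mzvalg_mod_mul +%R.
Proof.
move=> x y z; rewrite -[x]reprK -[y]reprK -[z]reprK.
by rewrite -pi_mzvalgD -!pi_mzvalg_mul -pi_mzvalgD mulrDl.
Qed.

HB.instance Definition _ := GRing.Zmodule_isComPzRing.Build mzvalg_mod
  mzvalg_modA mzvalg_modC mzvalg_mod1l mzvalg_modDl.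

Definition zeta_F (k : mzindex) : mzvalg_mod := \pi_mzvalg_mod (zeta_star_F k).

Lemma zeta_F_sum_eq0 (I : Type) (r : seq I) (f : I -> mzindex) :
  \sum_(i <- r) zeta_F (f i) = 0 <->
  \sum_(i <- r) zeta_star_F (f i) \in zeta2_ideal.
Proof.
have -> : \sum_(i <- r) zeta_F (f i) =
    \pi_mzvalg_mod (\sum_(i <- r) zeta_star_F (f i)).
  elim: r => [|i r IH]; first by rewrite !big_nil pi_mzvalg0.
  by rewrite !big_cons IH pi_mzvalgD.
have := idealrBE (zeta2_ideal : zmodClosed _) (\sum_(i <- r) zeta_star_F (f i)) 0.
move=> e; rewrite subr0 in e; rewrite e; rewrite -pi_mzvalg0.
by split=> [->|/eqP->].
Qed.

End FiniteRealMZV.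

(* Main.v *)
Require Import Defs.
From mathcomp Require Import all_boot all_order all_algebra all_fingroup.
From mathcomp Require Import all_classical all_reals all_analysis.
From mathcomp Require Import ring lra.

(* The map [zeta_star_F] is the deconcatenation convolution of [zeta_star]    *)
(* with [u |-> (-1)^(weight u) zeta_star (rev u)]; both are multiplicative    *)
(* for the stuffle product with a single letter, and so is their convolution. *)
(* Stuffling a letter [a] into all orderings of [k] gives all orderings of    *)
(* [a :: k] plus those of the words where [a] is added to an entry of [k].    *)
(* Induction on the depth therefore expresses the symmetric sum through the   *)
(* values at single letters, [zeta_star_F [:: a] = (1 + (-1)^a) zeta_star     *)
(* [:: a]]: these vanish for odd [a], and for even [a] they lie in the ideal  *)
(* of [zeta(2)], by the recursion                                             *)
(* [\sum_(0 < i < n) zeta(2i) zeta(2n - 2i) = (n + 1/2) zeta(2n)].            *)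

Set Implicit Arguments.
Unset Strict Implicit.
Unset Printing Implicit Defensive.

Import Order.TTheory GRing.Theory Num.Theory.
Import numFieldNormedType.Exports.
Local Open Scope classical_set_scope.
Local Open Scope ring_scope.

(** Let F be [zeta_star_F], and let S(k) be the sum of F over all orderings of k, counted with
    multiplicity. As F is multiplicative against single letters ([zeta_star_F_mult]), regrouping the
    stuffles ([sum_arrangements_stuffle1]) gives F(a) S(k) = S(a :: k) + sum over i of S(k with k_i
    replaced by a + k_i). The merged words are one letter shorter than a :: k, so induction leaves
    only the membership of F(a) in the ideal ([zeta_star_F_letter]). Its even case rests on
    [mzv_even_conv], the limit of an exact identity between truncated sums whose error is O(H_N /
    N). *)

(** * Orderings of a word, with multiplicity *)

Section Arrangements.
Context {T : eqType}.
Implicit Types (a b : T) (s p v : seq T).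

Fixpoint insertions a v : seq (seq T) :=
  (a :: v) :: if v is b :: v' then [seq b :: w | w <- insertions a v'] else [::].

(** Equal letters are treated as distinct, so the list always has n! entries, as does a sum over the
    symmetric group. *)
Fixpoint arrangements s : seq (seq T) :=
  if s is a :: s' then flatten [seq insertions a p | p <- arrangements s']
  else [:: [::]].

Lemma size_insertions a v : size (insertions a v) = (size v).+1.
Proof. by elim: v => //= b v IH; rewrite size_map IH. Qed.

Lemma mem_insertions a u v : u ++ a :: v \in insertions a (u ++ v).
Proof.
elim: u => [|b u IH] /=; first by case: v => *; rewrite mem_head.
by rewrite in_cons map_f ?orbT.
Qed.

Lemma size_insertions_mem a v p : p \in insertions a v -> size p = (size v).+1.
Proof.
elim: v p => [|b v IH] p /=; first by rewrite inE => /eqP->.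
by rewrite in_cons => /orP[/eqP->//|/mapP[w /IH e ->]] /=; rewrite e.
Qed.

Lemma size_arrangements_mem s p : p \in arrangements s -> size p = size s.
Proof.
elim: s p => [|a s IH] p /=; first by rewrite inE => /eqP->.
by move=> /flattenP[_ /mapP[q /IH e ->]] /size_insertions_mem->; rewrite e.
Qed.

Lemma size_arrangements s : size (arrangements s) = (size s)`!.
Proof.
elim: s => //= a s IH; rewrite size_flatten /shape -map_comp factS -IH.
rewrite -[LHS]/(sumn [seq size (insertions a p) | p <- arrangements s]).
rewrite sumnE big_map (eq_big_seq (fun=> (size s).+1)); last first.
  by move=> p /size_arrangements_mem /= <-; rewrite size_insertions.
by rewrite big_const_seq count_predT iter_addn_0.
Qed.

Lemma mem_arrangements s p : perm_eq p s -> p \in arrangements s.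
Proof.
elim: s p => [|a s IH] p /=; first by move/perm_nilP->.
move=> ps; have ap : a \in p by rewrite (perm_mem ps) mem_head.
case/splitPr: ap ps => u v; rewrite perm_catC /= perm_cons perm_catC => ps.
apply/flattenP; exists (insertions a (u ++ v)); last exact: mem_insertions.
exact/map_f/IH.
Qed.

End Arrangements.

Lemma map_insertions (T U : eqType) (h : T -> U) a v :
  insertions (h a) (map h v) = map (map h) (insertions a v).
Proof. by elim: v => //= b v ->; rewrite -!map_comp. Qed.

Lemma map_arrangements (T U : eqType) (h : T -> U) s :
  arrangements (map h s) = map (map h) (arrangements s).
Proof.
elim: s => //= a s ->; rewrite map_flatten -!map_comp; congr flatten.
by apply: eq_map => p /=; rewrite map_insertions.
Qed.

(** The left list is duplicate-free, is included in the right one, and both have n! entries.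
    Ordinals are used because they are distinct; [map_arrangements] then transports the result to
    words with repeated letters. *)
Lemma arrangements_perm n :
  perm_eq [seq [seq s i | i : 'I_n] | s : 'S_n] (arrangements (enum 'I_n)).
Proof.
set L := [seq _ | s : _]; have uL : uniq L.
  rewrite map_inj_uniq ?enum_uniq // => s t st; apply/permP => i.
  by move/eq_in_map: st; apply; rewrite mem_enum.
have sub : {subset L <= arrangements (enum 'I_n)}.
  move=> _ /mapP[s _ ->]; apply: mem_arrangements.
  apply: uniq_perm; rewrite ?enum_uniq //.
    by rewrite map_inj_uniq ?enum_uniq //; exact: perm_inj.
  move=> i; rewrite mem_enum inE; apply/mapP; exists ((s^-1)%g i); rewrite ?mem_enum //.
  by rewrite permKV.
have sz : (size (arrangements (enum 'I_n)) <= size L)%N.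
  by rewrite size_arrangements size_image card_Sn size_enum_ord.
have [_ m] := uniq_min_size uL sub sz.
exact: uniq_perm uL (leq_size_uniq uL sub sz) m.
Qed.

(** * Stuffle product with a single letter *)

Section LetterStuffle.
Variable V : nmodType.
Implicit Types (a b : posnat) (u v w : mzindex) (f : mzindex -> V).

Fixpoint merges a v : seq mzindex :=
  if v is b :: v' then (addp a b :: v') :: [seq b :: w | w <- merges a v'] else [::].

Lemma sum_stuffle1 f a b v :
  \sum_(w <- stuffle [:: a] (b :: v)) f w =
  f [:: a, b & v] + \sum_(w <- stuffle [:: a] v) f (b :: w) + f (addp a b :: v).
Proof. by rewrite stuffleE !big_cat /= !big_map !big_seq1 addrA. Qed.

Lemma sum_insertions_cons f a b v :
  \sum_(w <- insertions a (b :: v)) f w =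
  f [:: a, b & v] + \sum_(w <- insertions a v) f (b :: w).
Proof. by rewrite big_cons big_map. Qed.

Lemma sum_merges_cons f a b v :
  \sum_(w <- merges a (b :: v)) f w =
  f (addp a b :: v) + \sum_(w <- merges a v) f (b :: w).
Proof. by rewrite big_cons big_map. Qed.

Lemma sum_stuffle1E f a v :
  \sum_(w <- stuffle [:: a] v) f w =
  \sum_(w <- insertions a v) f w + \sum_(w <- merges a v) f w.
Proof.
elim: v f => [|b v IH] f; first by rewrite stufflenil !big_seq1 big_nil addr0.
rewrite sum_stuffle1 IH sum_insertions_cons sum_merges_cons -!addrA; congr (_ + (_ + _)).
by rewrite addrC.
Qed.

(** The stuffle recursion read from the right end, which makes it compatible with reversal. *)
Lemma sum_stuffle1_rcons f a b v :
  \sum_(w <- stuffle [:: a] (rcons v b)) f w =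
  f (rcons (rcons v b) a) + \sum_(w <- stuffle [:: a] v) f (rcons w b) +
  f (rcons v (addp a b)).
Proof.
elim: v f => [|c v IH] f.
  by rewrite sum_stuffle1 !stufflenil !big_seq1 [f _ + f _]addrC.
rewrite !rcons_cons !sum_stuffle1 IH /=.
rewrite -!rcons_cons -!addrA [LHS]addrCA; congr (_ + (_ + _)).
by congr (_ + _); rewrite addrC.
Qed.

Lemma sum_stuffle1_rev f a v :
  \sum_(w <- stuffle [:: a] v) f (rev w) = \sum_(w <- stuffle [:: a] (rev v)) f w.
Proof.
elim: v f => [|b v IH] f; first by rewrite !stufflenil !big_seq1.
rewrite [rev (b :: v)]rev_cons sum_stuffle1_rcons sum_stuffle1 !rev_cons.
rewrite -(IH (fun w => f (rcons w b))).
by congr (_ + _ + _); apply: eq_bigr => w _; rewrite rev_cons.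
Qed.

(** After [b] is inserted, [a] is merged either into [b] itself or into an entry of [v]; in the
    latter case the two operations commute. *)
Lemma sum_merges_insertions f a b v :
  \sum_(q <- insertions b v) \sum_(w <- merges a q) f w =
  \sum_(w <- insertions (addp a b) v) f w +
  \sum_(q <- merges a v) \sum_(w <- insertions b q) f w.
Proof.
elim: v f => [|c v IH] f; first by rewrite !big_seq1 big_nil addr0.
rewrite !sum_insertions_cons !sum_merges_cons !sum_insertions_cons.
rewrite (eq_bigr _ (fun q _ => sum_merges_cons f a c q)) big_split /= IH.
rewrite (eq_bigr _ (fun q _ => sum_insertions_cons f b c q)) big_split /=.
rewrite -!addrA; congr (_ + _); rewrite [RHS]addrCA; congr (_ + _).
by rewrite [LHS]addrCA [RHS]addrCA; congr (_ + _); rewrite addrCA.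
Qed.

Lemma sum_arrangements_merges f a s :
  \sum_(p <- arrangements s) \sum_(w <- merges a p) f w =
  \sum_(t <- merges a s) \sum_(p <- arrangements t) f p.
Proof.
elim: s f => [|b s IH] f; first by rewrite big_seq1 !big_nil.
rewrite /= !big_cons !big_map /= !big_flatten !big_map.
under eq_bigr do rewrite sum_merges_insertions.
rewrite big_split /= IH; congr (_ + _).
by apply: eq_bigr => t _; rewrite big_flatten big_map.
Qed.

Lemma sum_arrangements_stuffle1 f a s :
  \sum_(p <- arrangements s) \sum_(w <- stuffle [:: a] p) f w =
  \sum_(p <- arrangements (a :: s)) f p +
  \sum_(t <- merges a s) \sum_(p <- arrangements t) f p.
Proof.
under eq_bigr do rewrite sum_stuffle1E.
by rewrite big_split sum_arrangements_merges /= big_flatten big_map.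
Qed.

End LetterStuffle.

Lemma size_merges a v t : t \in merges a v -> size t = size v.
Proof.
elim: v t => //= b v IH t; rewrite in_cons => /orP[/eqP->//|/mapP[w /IH e ->]].
by rewrite /= e.
Qed.

(** * Convolution for deconcatenation *)

Section Deconcatenation.
Variable A : comPzRingType.
Implicit Types (f g : mzindex -> A) (a b : posnat) (v w : mzindex).

Definition deconv f g w : A :=
  \sum_(0 <= i < (size w).+1) f (take i w) * g (drop i w).

Lemma deconv_nil f g : deconv f g [::] = f [::] * g [::].
Proof. by rewrite /deconv big_nat1. Qed.

Lemma deconv_cons f g b w :
  deconv f g (b :: w) = f [::] * g (b :: w) + deconv (fun u => f (b :: u)) g w.
Proof. by rewrite /deconv big_nat_recl. Qed.

Lemma deconvDl f1 f2 g w :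
  deconv (fun u => f1 u + f2 u) g w = deconv f1 g w + deconv f2 g w.
Proof. by rewrite -big_split; apply: eq_bigr => i _; rewrite mulrDl. Qed.

Lemma eq_deconv f1 f2 g1 g2 w :
  f1 =1 f2 -> g1 =1 g2 -> deconv f1 g1 w = deconv f2 g2 w.
Proof. by move=> ef eg; apply: eq_bigr => i _; rewrite ef eg. Qed.

(* Stuffling with one letter is a coderivation for deconcatenation, because   *)
(* that letter is primitive.                                                  *)
Lemma deconv_stuffle1 f g a v :
  \sum_(w <- stuffle [:: a] v) deconv f g w =
  deconv (fun u => \sum_(w <- stuffle [:: a] u) f w) g v +
  deconv f (fun u => \sum_(w <- stuffle [:: a] u) g w) v.
Proof.
(* [f] stays general because [deconv_cons] replaces it by its shift under [b]. *)
elim: v f => [|b v IH] f.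
  rewrite !deconv_nil !stufflenil !big_seq1 deconv_cons deconv_nil.
  by rewrite addrC.
rewrite sum_stuffle1 !deconv_cons sum_stuffle1 stufflenil big_seq1.
under eq_bigr do rewrite deconv_cons.
rewrite big_split /= IH -mulr_sumr.
rewrite (@eq_deconv (fun u => \sum_(w <- stuffle [:: a] (b :: u)) f w)
  (fun u => f [:: a, b & u] + \sum_(w <- stuffle [:: a] u) f (b :: w) + f (addp a b :: u))
  g g v) => [|u|//]; last exact: sum_stuffle1.
rewrite !deconvDl; ring.
Qed.

(** Only products with one letter are required: the induction on depth never multiplies longer
    words. *)
Definition letter_mult f := forall a v,
  f [:: a] * f v = \sum_(w <- stuffle [:: a] v) f w.

Lemma deconv_mult f g : f [::] = 1 -> g [::] = 1 ->
  letter_mult f -> letter_mult g -> letter_mult (deconv f g).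
Proof.
move=> f1 g1 fM gM a v; rewrite deconv_stuffle1 deconv_cons deconv_nil f1 g1.
rewrite mul1r mulr1 mulrDl addrC /deconv !mulr_sumr.
by congr (_ + _); apply: eq_bigr => i _; rewrite -?fM -?gM; ring.
Qed.

End Deconcatenation.

(** * Even zeta values: a recursion by partial fractions *)

Section EvenZeta.
Variable R : realType.
Local Notation H n := (@harmsum R n%N).

Definition evenp (j : nat) : posnat := @posn j.*2.+2 isT.

Lemma mzv_trunc1 a N : mzv_trunc R [:: a] N = \sum_(1 <= m < N) m%:R ^- val a.
Proof. by apply: eq_bigr => m _; rewrite mulr1. Qed.

Lemma harmsumE N : H N = \sum_(1 <= m < N) m%:R^-1.
Proof. by rewrite /harmsum mzv_trunc1. Qed.

(** Partial fractions: 1/(s^2 - r^2) = -(1/(r - s) + 1/(r + s))/(2r). Here [H N] stops at 1/(N -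
    1). *)
Lemma sum_inv_subrX2_diag r : (0 < r)%N ->
  \sum_(1 <= s < r) (s%:R ^+ 2 - r%:R ^+ 2)^-1 =
  (2 * r%:R)^-1 * (r%:R^-1 - H (r + r)) :> R.
Proof.
move=> r0.
have E : \sum_(1 <= s < r) (r%:R - s%:R)^-1 = H r :> R.
  rewrite harmsumE big_nat_rev /= add1n; apply: eq_big_nat => s /andP[s1 sr].
  by rewrite subSS natrB 1?ltnW // opprB addrC subrK.
have F : \sum_(1 <= s < r) (r%:R + s%:R)^-1 = H (r + r) - H r - r%:R^-1 :> R.
  rewrite !harmsumE (big_cat_nat r0 (leq_addr r r)) /= [X in X - r%:R^-1]addrAC subrr add0r.
  rewrite (@big_ltn _ _ _ r); last by rewrite -[ltnLHS]addn0 ltn_add2l.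
  rewrite addrAC subrr add0r -[r.+1]add1n big_addn addnK.
  by apply: eq_bigr => s _; rewrite addnC natrD.
have rn0 : r%:R != 0 :> R by rewrite pnatr_eq0 -lt0n.
rewrite (eq_big_nat _ _ (F2 := fun s => - (2 * r%:R)^-1 *
   ((r%:R - s%:R)^-1 + (r%:R + s%:R)^-1))); last first.
  move=> s /andP[s1 sr].
  have : (s%:R : R) < r%:R by rewrite ltr_nat.
  have : 0 < (s%:R : R) by rewrite ltr0n.
  move: (s%:R : R) (r%:R : R) => x y x0 xy; field.
  by apply/and4P; split; apply/eqP; nra.
rewrite -mulr_sumr big_split /= E F; ring.
Qed.

(* The junk value [0^-1 = 0] removes the term [s = r]. *)
Lemma sum_inv_subrX2 r N : (0 < r < N)%N ->
  \sum_(1 <= s < N) (s%:R ^+ 2 - r%:R ^+ 2)^-1 =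
  3 / 4 * r%:R ^- 2 - (2 * r%:R)^-1 * (H (N + r) - H (N - r)) :> R.
Proof.
move=> /andP[r0 rN]; have rn0 : r%:R != 0 :> R by rewrite pnatr_eq0 -lt0n.
(* Induction on N from r + 1, where the sum is the diagonal one plus the null term s = r. *)
rewrite -(subnKC rN); elim: (N - r.+1)%N => [|d IH].
  rewrite addn0 subSn // subnn big_nat_recr //= subrr invr0 addr0.
  rewrite sum_inv_subrX2_diag // addSn HS ?addn_gt0 ?r0 //.
  rewrite [H 1]harmsumE big_geq // natrD; field.
 by rewrite rn0 -natrD pnatr_eq0 -lt0n addn_gt0 r0.
move: IH; rewrite addnS addSnnS; set M := (r + d.+1)%N => IH.
have rM : (r <= M)%N by exact: leq_addr.
have M0 : (0 < M)%N by exact: leq_trans rM.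
rewrite big_nat_recr //= IH addSn HS; last by rewrite addn_gt0 M0.
rewrite subSn // /M addKn.
rewrite [H d.+2]HS // !natrD -natr1 -[d.+1%:R]natr1.
have := ler0n R d; have : 0 < (r%:R : R) by rewrite ltr0n.
move: (r%:R : R) (d%:R : R) => x y x0 y0; field.
by apply/and4P; split; apply/eqP; nra.
Qed.

(** A finite geometric sum. With division by 0 equal to 0, one formula covers both cases: for a = b
    only the first term survives, otherwise only the second. For a = r^-2 and b = s^-2 the
    denominators are s^2 - r^2 and its opposite. *)
Lemma geo_pair_sum (a b : R) n : a != 0 -> b != 0 ->
  \sum_(i < n.+1) (a ^+ i.+1 * b ^+ (n - i).+1) =
  (a == b)%:R * (n.+1%:R * a ^+ n.+2) +
  (a ^+ n.+1 / (b^-1 - a^-1) + b ^+ n.+1 / (a^-1 - b^-1)).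
Proof.
move=> a0 b0; have [->|ab] := eqVneq a b.
  rewrite subrr invr0 !mulr0 !addr0 mul1r mulr_natl.
  rewrite (eq_bigr (fun=> b ^+ n.+2)); first by rewrite sumr_const card_ord.
  by move=> i _; rewrite -exprD addSn addnS subnKC // -ltnS.
rewrite mul0r add0r.
have e : (a - b) * \sum_(i < n.+1) (a ^+ i.+1 * b ^+ (n - i).+1) =
    a * b * (a ^+ n.+1 - b ^+ n.+1).
  rewrite subrXX mulrCA; congr (_ * _).
  rewrite mulr_sumr (reindex_inj rev_ord_inj) /=; apply: eq_bigr => i _.
  rewrite !subSS subKn; last by rewrite -ltnS.
  by rewrite !exprS; ring.
have ab0 : a - b != 0 by rewrite subr_eq0.
apply: (mulfI ab0); rewrite e; field.
by rewrite a0 b0 !mulN1r ab0 subr_eq0 eq_sym ab.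
Qed.

(** In the double sum over (r, s), the diagonal contributes m + 1; the two off-diagonal parts agree
    by symmetry and contribute 2 * 3/4 through [sum_inv_subrX2], for a total of m + 5/2. *)
Lemma mzv_trunc_even_conv m N :
  \sum_(i < m.+1) mzv_trunc R [:: evenp i] N * mzv_trunc R [:: evenp (m - i)] N =
  (m%:R + 5 / 2) * mzv_trunc R [:: evenp m.+1] N -
  \sum_(1 <= r < N) r%:R ^- (m.*2.+3) * (H (N + r) - H (N - r)).
Proof.
pose D r s : R := (s%:R ^+ 2 - r%:R ^+ 2)^-1.
pose c r : R := r%:R ^- m.*2.+2.
transitivity (\sum_(1 <= r < N) \sum_(1 <= s < N)
    ((r == s)%:R * (m.+1%:R * r%:R ^- m.*2.+4) + (c r * D r s + c s * D s r))).
  under eq_bigr do rewrite !mzv_trunc1 mulr_suml.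
  rewrite exchange_big /=; apply: eq_big_nat => r /andP[r1 _].
  under eq_bigr do rewrite mulr_sumr.
  rewrite exchange_big /=; apply: eq_big_nat => s /andP[s1 _].
  have inv0 (t : nat) : (0 < t)%N -> (t%:R ^- 2 : R) != 0.
    by move=> t0; rewrite invr_eq0 expf_neq0 // pnatr_eq0 -lt0n.
  have X2 (t k : nat) : (t%:R ^- k.*2.+2 : R) = (t%:R ^- 2) ^+ k.+1.
    by rewrite exprVn -exprM mulnC muln2.
  under eq_bigr do rewrite !X2.
  rewrite geo_pair_sum ?inv0 // !invrK /c /D !X2 -[m.*2.+4]/(m.+1.*2.+2) X2.
  by rewrite (inj_eq invr_inj) eqrXn2 // eqr_nat.
have -> : \sum_(1 <= r < N) \sum_(1 <= s < N)
    ((r == s)%:R * (m.+1%:R * r%:R ^- m.*2.+4) + (c r * D r s + c s * D s r)) =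
    \sum_(1 <= r < N) (m.+1%:R * r%:R ^- m.*2.+4 + 2 * (c r * \sum_(1 <= s < N) D r s)).
  under eq_bigr do rewrite !big_split /=.
  rewrite !big_split /= [X in _ + (_ + X)]exchange_big /=; congr (_ + _).
    apply: eq_big_nat => r rN.
    rewrite (bigD1_seq r) ?iota_uniq ?mem_index_iota //= eqxx mul1r big1 ?addr0 //.
    by move=> s; rewrite eq_sym => /negPf->; rewrite mul0r.
  rewrite -mulr_sumr -mulr2n mulr_natl; congr (_ *+ 2).
  by apply: eq_bigr => r _; rewrite mulr_sumr.
rewrite mzv_trunc1 mulr_sumr -sumrB; apply: eq_big_nat => r /andP[r1 rN].
rewrite sum_inv_subrX2 ?r1 // /c /= doubleS -natr1 !exprS !invfM.
have : (r%:R : R) != 0 by rewrite pnatr_eq0 -lt0n.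
move: (H (N + r) - H (N - r)) (r%:R : R) (r%:R ^+ m.*2 : R) => h x y x0.
move: (y^-1) => z; field.
exact: x0.
Qed.

Lemma harmsum_diff_le N r : (0 < r < N)%N ->
  0 <= H (N + r) - H (N - r) <= 2 * r%:R / (N - r)%:R.
Proof.
move=> /andP[r0 rN].
have k1 : (0 < N - r)%N by rewrite subn_gt0.
rewrite !harmsumE (big_cat_nat k1 (leq_trans (leq_subr r N) (leq_addr r N))) /=.
rewrite addrAC subrr add0r sumr_ge0 /=; last by move=> i _; rewrite invr_ge0.
apply: (@le_trans _ _ (\sum_(N - r <= i < N + r) (N - r)%:R^-1)).
  apply: ler_sum_nat => i /andP[i1 _].
  rewrite lef_pV2 ?posrE ?ltr0n ?ler_nat //; exact: leq_trans i1.
rewrite sumr_const_nat.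
have -> : (N + r - (N - r) = 2 * r)%N by rewrite subnBA 1?ltnW // -addnA addKn addnn mul2n.
by rewrite -[leLHS]mulr_natl natrM.
Qed.

(** As r^-(2m+3) <= r^-2, each term is at most 2/(r (N - r)) = (2/N) (1/r + 1/(N - r)), and both
    parts sum to H_N. *)
Lemma mzv_trunc_even_err m N : (0 < N)%N ->
  0 <= \sum_(1 <= r < N) r%:R ^- (m.*2.+3) * (H (N + r) - H (N - r)) <=
  4 * (H N / N%:R).
Proof.
move=> N0; apply/andP; split.
  rewrite big_nat_cond sumr_ge0 // => r; rewrite andbT => rN.
  by have /andP[h _] := harmsum_diff_le rN; rewrite mulr_ge0.
apply: (@le_trans _ _ (\sum_(1 <= r < N) (2 / N%:R) * (r%:R^-1 + (N - r)%:R^-1))).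
  apply: ler_sum_nat => r rN; have /andP[h1 h2] := harmsum_diff_le rN.
  case/andP: rN => r0 rN.
  have x0 : 0 < (r%:R : R) by rewrite ltr0n.
  have x1 : 1 <= (r%:R : R) by rewrite ler1n.
  have y0 : 0 < ((N - r)%:R : R) by rewrite ltr0n subn_gt0.
  have -> : N%:R = r%:R + (N - r)%:R :> R by rewrite -natrD subnKC // ltnW.
  apply: (@le_trans _ _ (r%:R ^- 2 * (2 * r%:R / (N - r)%:R))).
    apply: ler_pM => //.
    rewrite lef_pV2 ?posrE ?exprn_gt0 //; exact: ler_weXn2l.
  move: (r%:R : R) ((N - r)%:R : R) x0 y0 {h1 h2 x1} => x y x0 y0.
  rewrite le_eqVlt; apply/orP; left; apply/eqP; field.
  by rewrite !lt0r_neq0 // addr_gt0.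
rewrite -mulr_sumr big_split /= -harmsumE.
have -> : \sum_(1 <= i < N) (N - i)%:R^-1 = H N.
  rewrite harmsumE big_nat_rev /=; apply: eq_big_nat => i /andP[i1 iN].
  by rewrite add1n subSS subKn // ltnW.
by rewrite -mulr2n -mulr_natr le_eqVlt; apply/orP; left; apply/eqP; ring.
Qed.

(** Cesaro means of the null sequence 1/(n + 1). *)
Lemma harmsum_mean_cvg0 : H N / N%:R @[N --> \oo] --> (0 : R).
Proof.
rewrite -(cvg_shiftn 2).
have c := cesaro (@cvg_harmonic R).
apply: (@squeeze_cvgr _ _ _ _ (fun=> 0) (arithmetic_mean (@harmonic R))) => //.
  apply: nearW => n; rewrite divr_ge0 ?H_ge0 //=.
  rewrite /arithmetic_mean /= addn2 mulrC.
  have -> : H n.+2 = series (@harmonic R) n.+1.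
    by rewrite harmsumE seriesEnat /= big_add1.
  apply: ler_wpM2r; last by rewrite lef_pV2 ?posrE ?ltr0n // ler_nat.
  by apply: sumr_ge0 => i _; exact: harmonic_ge0.
exact: cvg_cst.
Qed.

(* Williams' recursion, an elementary substitute for Euler's evaluation.      *)
Lemma mzv_even_conv m :
  \sum_(i < m.+1) mzv R [:: evenp i] * mzv R [:: evenp (m - i)] =
  (m%:R + 5 / 2) * mzv R [:: evenp m.+1].
Proof.
have zc j : mzv_trunc R [:: evenp j] N @[N --> \oo] --> mzv R [:: evenp j].
  exact: mzv_trunc_cvg.
pose E N : R := \sum_(1 <= r < N) r%:R ^- (m.*2.+3) * (H (N + r) - H (N - r)).
have E0 : E N @[N --> \oo] --> (0 : R).
  apply: (@squeeze_cvgr _ _ _ _ (fun=> 0) (fun N => 4 * (H N / N%:R))).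
  - near=> N; apply: mzv_trunc_even_err; near: N; exact: nbhs_infty_gt.
  - exact: cvg_cst.
  - by rewrite -(mulr0 4); apply: cvgMl_tmp; exact: harmsum_mean_cvg0.
have c1 : \sum_(i < m.+1) mzv_trunc R [:: evenp i] N *
    mzv_trunc R [:: evenp (m - i)] N @[N --> \oo] -->
    \sum_(i < m.+1) mzv R [:: evenp i] * mzv R [:: evenp (m - i)].
  by apply: cvg_big => [|i _]; [exact: add_continuous|apply: cvgM].
have c2 : (m%:R + 5 / 2) * mzv_trunc R [:: evenp m.+1] N - E N @[N --> \oo] -->
    (m%:R + 5 / 2) * mzv R [:: evenp m.+1] - 0.
  by apply: cvgB => //; apply: cvgMl_tmp.
move: c1; under eq_fun do rewrite mzv_trunc_even_conv.
rewrite subr0 in c2 => c1.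
by rewrite -(cvg_lim (@norm_hausdorff _ _) c1) (cvg_lim _ c2).
Unshelve. all: by end_near.
Qed.

End EvenZeta.

(** * Symmetric sums modulo zeta(2) *)

Section SymmetricSums.
Variable R : realType.
Local Notation mzvalg := (mzvalg R).

Lemma zeta_star_evenp j : zeta_star R [:: evenp j] \in @zeta2_ideal R.
Proof.
suff [z hz e] : exists2 z : R, z \in @mzv_span R & mzv R [:: evenp j] = mzv R [:: twop] * z.
  by apply/zeta2_idealP; exists (MZVAlg hz); apply: val_inj; rewrite zeta_star_adm.
elim/ltn_ind: j => -[_|j IH].
  by exists 1; [exact: rpred1|rewrite mulr1; congr (mzv R [:: _]); exact: val_inj].
have q0 : 0 < j%:R + 5 / 2 :> R by have := ler0n R j; lra.
have /choice[z hz] : forall i : 'I_j.+1, exists z : R, z \in @mzv_span R /\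
    mzv R [:: evenp i] = mzv R [:: twop] * z.
  by move=> i; have [z] := IH i (ltn_ord i); exists z.
(* The recursion solved for zeta(2j + 4): each product has a first factor divisible by zeta(2), and
   [ratr] keeps the quotient in the rational span. *)
exists (ratr (j%:R + 5 / 2)^-1 * \sum_(i < j.+1) z i * mzv R [:: evenp (j - i)]).
  apply/mzv_spanZ/mzv_span_sum => i _.
  by apply: mzv_spanM; [case: (hz i)|exact: mzv_in].
apply: (mulfI (lt0r_neq0 q0)); rewrite -mzv_even_conv.
rewrite fmorphV rmorphD fmorph_div /= !rmorph_nat mulrCA mulVKf ?lt0r_neq0 // mulr_sumr.
by apply: eq_bigr => i _; case: (hz i) => _ ->; rewrite mulrA.
Qed.

Lemma zeta_starM u v :
  zeta_star R u * zeta_star R v = \sum_(w <- stuffle u v) zeta_star R w.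
Proof.
have [_ _ hM] := harmonic_regP R.
apply: val_inj; rewrite rmorphM rmorph_sum /= -hornerM hM horner_sum.
by apply: eq_bigr.
Qed.

Lemma zeta_star_nil : zeta_star R [::] = 1.
Proof. by apply: val_inj; rewrite zeta_star_adm // mzv_nil. Qed.

Definition zeta_star_antipode (u : mzindex) : mzvalg :=
  (-1) ^+ weight u * zeta_star R (rev u).

Lemma weight_stuffle u v w : w \in stuffle u v -> weight w = (weight u + weight v)%N.
Proof.
rewrite /weight; elim: u v w => [|a u IHu] v w; first by rewrite inE big_nil => /eqP->.
elim: v w => [|b v IHv] w; first by rewrite inE big_nil addn0 => /eqP->.
rewrite stuffleE !mem_cat => /or3P[] /mapP[t ht ->]; rewrite !big_cons.
- by rewrite (IHu _ _ ht) big_cons addnA.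
- by rewrite (IHv _ ht) big_cons addnCA.
- by rewrite (IHu _ _ ht) addnACA.
Qed.

(** The weight is additive under stuffle, and stuffling with a letter commutes with reversal. *)
Lemma zeta_star_antipode_mult : letter_mult zeta_star_antipode.
Proof.
move=> a v; rewrite /zeta_star_antipode mulrACA -exprD zeta_starM.
rewrite -[rev [:: a]]/[:: a] -sum_stuffle1_rev mulr_sumr; apply: eq_big_seq => w.
by move=> /weight_stuffle->.
Qed.

Lemma zeta_star_F_deconv k :
  zeta_star_F R k = deconv zeta_star_antipode (zeta_star R) k.
Proof. by []. Qed.

Lemma zeta_star_F_mult : letter_mult (@zeta_star_F R).
Proof.
apply: (@deconv_mult _ zeta_star_antipode (zeta_star R)); rewrite ?zeta_star_nil //.
- by rewrite /zeta_star_antipode /weight big_nil expr0 mul1r zeta_star_nil.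
- exact: zeta_star_antipode_mult.
- by move=> a v; exact: zeta_starM.
Qed.

Lemma zeta_star_F_letter a : zeta_star_F R [:: a] \in @zeta2_ideal R.
Proof.
rewrite zeta_star_F_deconv deconv_cons deconv_nil /zeta_star_antipode.
rewrite /weight big_nil big_seq1 !zeta_star_nil !mul1r mulr1 -signr_odd.
(* For odd [a], including the regularized case a = 1, the two terms cancel. *)
case: (boolP (odd (val a))) => [_|ev]; first by rewrite mulN1r subrr rpred0.
have -> : a = evenp (val a)./2.-1.
  apply: val_inj => /=; have := even_halfK ev; have := valP a.
  by case: (_./2) => [|h] /= h0 e; rewrite -e in h0 *.
by rewrite mul1r rpredD // zeta_star_evenp.
Qed.

Lemma sum_arrangements_zeta_star_F k : k != [::] ->
  \sum_(p <- arrangements k) zeta_star_F R p \in @zeta2_ideal R.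
Proof.
have [n] := ubnP (size k); elim: n k => // n IHn [//|a [|b k]] kn _.
  by rewrite big_seq1 zeta_star_F_letter.
have := sum_arrangements_stuffle1 (@zeta_star_F R) a (b :: k).
under eq_bigr do rewrite -zeta_star_F_mult.
(* Solve for the sum over orderings of [[:: a, b & k]]: the product has the factor F(a) in the
   ideal, and the merged words are shorter but nonempty. *)
move=> /esym/(canRL (addrK _))->; rewrite rpredB //.
  by rewrite -mulr_sumr mulrC zeta2_idealMl // zeta_star_F_letter.
rewrite big_seq rpred_sum // => t /size_merges st.
by apply: IHn; [rewrite st|rewrite -size_eq0 st].
Qed.

End SymmetricSums.

Theorem theorem1p1 (R : realType) (n : nat) (k : 'I_n -> posnat) :
  (0 < n)%N ->
  \sum_(s : 'S_n) zeta_F R [seq k (s i) | i : 'I_n] = 0.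
Proof.
move=> n0; apply/zeta_F_sum_eq0.
have := @sum_arrangements_zeta_star_F R (map k (enum 'I_n)).
rewrite -size_eq0 size_map size_enum_ord -lt0n => /(_ n0).
rewrite map_arrangements big_map -(perm_big _ (arrangements_perm n)) big_image /=.
by under eq_bigr do rewrite -map_comp.
Qed.
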